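(* Let $n_1,\ldots,n_k$ be positive integers, $n=\sum_{i=1}^k n_i$, and let $\lambda_n$ be the least Seidel eigenvalue of the complete multipartite graph $K_{n_1,\ldots,n_k}$. Then $$\lambda_n\leq \frac{n}{k}-1-\frac{2}{k}\sum_{1\leq i<j\leq k} \sqrt{n_in_j}.$$
   Context: For a simple graph $G$ with adjacency matrix $A(G)$, the Seidel matrix is $S(G)=J-I-2A(G)$, where $I$ is the identity matrix and $J$ the all-ones matrix; Seidel eigenvalues of $G$ are the eigenvalues of $S(G)$. The complete multipartite graph $K_{n_1,\ldots,n_k}$ has vertex set partitioned into parts of sizes $n_1,\ldots,n_k$, two vertices being adjacent iff they lie in different parts. *)

(* Defs.v *)
From HB Require Import structures.
From mathcomp Require Import all_boot all_order all_algebra.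

Set Implicit Arguments.
Unset Strict Implicit.
Unset Printing Implicit Defensive.

Import Order.TTheory GRing.Theory Num.Theory.

Local Open Scope ring_scope.

Record sgraph := SGraph {
  svertex :> finType;
  sedge : rel svertex;
  sedge_sym : symmetric sedge;
  sedge_irrefl : irreflexive sedge
}.

(* Rows and columns follow the enumeration of the vertices given by
   [enum_val]; eigenvalues do not depend on this order. *)
Definition adjacency_mx (R : pzRingType) (G : sgraph) : 'M[R]_#|G| :=
  \matrix_(i, j) (sedge (enum_val i) (enum_val j))%:R.

Definition seidel_mx (R : pzRingType) (G : sgraph) : 'M[R]_#|G| :=
  const_mx 1 - 1%:M - 2%:R *: adjacency_mx R G.

(* [eigenvalue] ranges over [R] only: nothing is lost for a symmetric matrix
   over a real closed field, all of whose eigenvalues lie in that field. *)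
Definition is_least_eigenvalue (R : rcfType) (m : nat) (A : 'M[R]_m) (a : R) :=
  eigenvalue A a /\ forall b : R, eigenvalue A b -> a <= b.

Section CompleteMultipartite.

Variables (k : nat) (n : 'I_k -> nat).

(* The vertex [Tagged _ x], with [x : 'I_(n i)], is the x-th vertex of the
   i-th part. *)
Definition multipartite_vertex : finType := {i : 'I_k & 'I_(n i)}.

Definition multipartite_edge : rel multipartite_vertex :=
  fun u v => tag u != tag v.

Lemma multipartite_edge_sym : symmetric multipartite_edge.
Proof. by move=> u v; rewrite /multipartite_edge eq_sym. Qed.

Lemma multipartite_edge_irrefl : irreflexive multipartite_edge.
Proof. by move=> u; rewrite /multipartite_edge eqxx. Qed.

Definition complete_multipartite : sgraph :=
  SGraph multipartite_edge_sym multipartite_edge_irrefl.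

End CompleteMultipartite.

(* Main.v *)
Require Import Defs.
From HB Require Import structures.
From mathcomp Require Import all_boot all_order all_algebra.
From mathcomp Require Import complex ring.

Set Implicit Arguments.
Unset Strict Implicit.
Unset Printing Implicit Defensive.

Import Order.TTheory GRing.Theory Num.Theory.

Local Open Scope ring_scope.
Local Open Scope sesquilinear_scope.

(* The least eigenvalue of a symmetric matrix is at most every Rayleigh
   quotient.  Give each vertex of part i the weight 1 / sqrt n_i: the weight
   vector x has x x^T = k, its entries in part i sum to sqrt n_i, and
   x S x^T = (\sum_i sqrt n_i)^2 - k - 2 \sum_(i != j) sqrt n_i sqrt n_j. *)

(** With [P := spectralmx A], the spectral theorem gives [P *m A = diag_mx d *m P], so row [i] of
    [P] is an eigenvector; it is nonzero because [P] is invertible. *)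
Lemma spectral_diag_eigenvalue (C : numClosedFieldType) (m : nat)
    (A : 'M[C]_m) (i : 'I_m) :
  A \is normalmx -> eigenvalue A (spectral_diag A 0 i).
Proof.
move=> /orthomx_spectralP A_eq; have uP := spectral_unit A.
apply/eigenvalueP; exists (row i (spectralmx A)).
  by rewrite {2}A_eq -row_mul !mulmxA mulmxV // mul1mx row_mul row_diag_mx
    -scalemxAl -rowE.
apply/eqP => /(congr1 (mulmx^~ (invmx (spectralmx A)))).
rewrite -row_mul mulmxV // mul0mx => /rowP/(_ i)/eqP.
by rewrite !mxE eqxx oner_eq0.
Qed.

(** Over [R[i]] the symmetric matrix becomes Hermitian, hence unitarily diagonalisable. In an
    orthonormal eigenbasis the form is a sum of eigenvalues weighted by squared moduli of the
    coordinates. *)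
Lemma rayleigh_ge (R : rcfType) (m : nat) (A : 'M[R]_m) (a : R) (x : 'rV[R]_m) :
  A^T = A -> (forall b, eigenvalue A b -> a <= b) ->
  a * (x *m x^T) 0 0 <= (x *m A *m x^T) 0 0.
Proof.
move=> A_sym a_min; pose f := real_complex R.
have f_conj p q (B : 'M[R]_(p, q)) : (map_mx f B)^t* = map_mx f B^T.
  by apply/matrixP => i j; rewrite !mxE; exact: conjc_real.
have A_herm : map_mx f A \is hermsymmx.
  by apply/is_hermitianmxP; rewrite expr0 scale1r f_conj A_sym.
have A_normal := hermitian_normalmx A_herm.
have uP := spectral_unitarymx (map_mx f A).
have /orthomx_spectralP A_eq := A_normal.
(* The hypothesis on [a] only concerns eigenvalues in [R]. Those of a Hermitian matrix are real, so
   each is [f b] with [b] an eigenvalue of [A] itself. *)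
have d_ge i : f a <= spectral_diag (map_mx f A) 0 i.
  have /complex_realP[b d_eq] : spectral_diag (map_mx f A) 0 i \is Num.real.
    exact: (mxOverP (hermitian_spectral_diag_real A_herm)).
  have := spectral_diag_eigenvalue i A_normal; rewrite d_eq.
  by rewrite eigenvalue_map lecR => /a_min.
move: (spectral_diag _) d_ge A_eq => d d_ge; rewrite (invmx_unitary uP).
move: (spectralmx _) uP => P uP A_eq.
(* The coordinates of [x] in the eigenbasis formed by the rows of [P]; as [P] is unitary, the norm
   is preserved. *)
pose y := map_mx f x *m P^t*.
have y_adj : y^t* = P *m map_mx f x^T.
  by rewrite /y trmx_mul map_mxM /= trmxCK f_conj.
suff: f a * f ((x *m x^T) 0 0) <= f ((x *m A *m x^T) 0 0).
  by rewrite -rmorphM lecR.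
have -> : f ((x *m x^T) 0 0) = (y *m y^t*) 0 0.
  by rewrite y_adj /y mulmxA mulmxKtV // -map_mxM !mxE.
have -> : f ((x *m A *m x^T) 0 0) = (y *m diag_mx d *m y^t*) 0 0.
  by rewrite y_adj /y !mulmxA -(mulmxA (map_mx f x)) -(mulmxA (map_mx f x))
    -A_eq -!map_mxM !mxE.
rewrite mul_mx_diag !mxE mulr_sumr ler_sum // => i _; rewrite !mxE.
by rewrite mulrAC mulrC ler_wpM2l // mul_conjC_ge0.
Qed.

(** The three terms come from [J], [I] and [2A]. Summing over vertices removes the enumeration from
    later computations. *)
Lemma seidel_quadratic_form (R : comPzRingType) (G : sgraph) (f : G -> R) :
  let x : 'rV[R]_#|G| := \row_i f (enum_val i) in
  (x *m seidel_mx R G *m x^T) 0 0 =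
  (\sum_u f u) ^+ 2 - \sum_u f u ^+ 2
  - 2%:R * \sum_u f u * \sum_(v | sedge u v) f v.
Proof.
move=> x.
have enumE (g : G -> R) : \sum_(i < #|G|) g (enum_val i) = \sum_u g u.
  by rewrite -big_enum_val.
have entry u : \sum_v f v * (1 - (v == u)%:R - 2%:R * (sedge v u)%:R)
    = \sum_v f v - f u - 2%:R * \sum_(v | sedge u v) f v.
  have -> : f u = \sum_v f v * (v == u)%:R.
    rewrite (bigD1 u) //= eqxx mulr1 big1 ?addr0 // => v /negbTE->.
    by rewrite mulr0.
  rewrite mulr_sumr [X in _ - X]big_mkcond -!sumrB; apply: eq_bigr => v _.
  by rewrite sedge_sym; case: (sedge u v) => /=; ring.
rewrite mxE expr2 mulr_suml mulr_sumr -!sumrB -[RHS]enumE.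
apply: eq_bigr => j _.
suff -> : (x *m seidel_mx R G) 0 j
    = \sum_v f v * (1 - (v == enum_val j)%:R - 2%:R * (sedge v (enum_val j))%:R).
  by rewrite entry !mxE; ring.
rewrite -enumE mxE; apply: eq_bigr => i _.
by rewrite !mxE (inj_eq enum_val_inj).
Qed.

Lemma sum_offdiag_sym (R : pzSemiRingType) (k : nat) (F : 'I_k -> 'I_k -> R) :
  (forall i j, F i j = F j i) ->
  \sum_i \sum_(j | i != j) F i j
  = 2%:R * \sum_(i < k) \sum_(j < k | (i < j)%N) F i j.
Proof.
move=> F_sym; have -> : \sum_i \sum_(j | i != j) F i j
    = \sum_(i < k) \sum_(j < k | (i < j)%N) F i j
      + \sum_(i < k) \sum_(j < k | (j < i)%N) F i j.
  rewrite -big_split; apply: eq_bigr => i _ /=.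
  rewrite (bigID (fun j : 'I_k => (i < j)%N)) /=.
  by congr (_ + _); apply: eq_bigl => j; rewrite -val_eqE /=;
    case: ltngtP.
rewrite [X in _ + X](exchange_big_dep xpredT) //= mulr_natl mulr2n.
by congr (_ + _); apply: eq_bigr => i _; apply: eq_bigr => j _.
Qed.

(** The predicate [P] on parts allows sums over a neighbourhood, which is the union of all parts but
    one. *)
Lemma sum_multipartite (R : nmodType) (k : nat) (n : 'I_k -> nat)
    (P : pred 'I_k) (F : 'I_k -> R) :
  \sum_(u : complete_multipartite n | P (tag u)) F (tag u)
  = \sum_(i | P i) F i *+ n i.
Proof.
transitivity (\sum_(i | P i) \sum_(a : 'I_(n i)) F i).
  by rewrite sig_big_dep; apply: eq_bigl => u; rewrite andbT.
by apply: eq_bigr => i _; rewrite sumr_const card_ord.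
Qed.

Theorem theorem2p5 (R : rcfType) (k : nat) (n : 'I_k -> nat)
    (k_gt0 : (0 < k)%N) (n_gt0 : forall i : 'I_k, (0 < n i)%N) (lambda : R)
    (lambda_least :
       is_least_eigenvalue (seidel_mx R (complete_multipartite n)) lambda) :
  lambda <= (\sum_(i < k) n i)%N%:R / k%:R - 1
            - 2%:R / k%:R *
              \sum_(i < k) \sum_(j < k | (i < j)%N)
                Num.sqrt ((n i)%:R * (n j)%:R).
Proof.
have [_ lambda_min] := lambda_least.
pose s i : R := Num.sqrt (n i)%:R.
have s_neq0 i : s i != 0 by rewrite gt_eqF // sqrtr_gt0 ltr0n.
have sqr_s i : s i ^+ 2 = (n i)%:R by rewrite sqr_sqrtr ?ler0n.
(* The [n i] equal weights of part [i] add up to [s i]. *)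
have inv_s i : (s i)^-1 *+ n i = s i.
  by rewrite -mulr_natl -sqr_s expr2 mulfK.
pose f (u : complete_multipartite n) := (s (tag u))^-1.
pose x : 'rV[R]_#|complete_multipartite n| := \row_i f (enum_val i).
have S_sym : (seidel_mx R (complete_multipartite n))^T
    = seidel_mx R (complete_multipartite n).
  by apply/matrixP => i j; rewrite !mxE sedge_sym eq_sym.
have := rayleigh_ge x S_sym lambda_min.
rewrite seidel_quadratic_form.
have sum_f2 : \sum_u f u ^+ 2 = k%:R.
  rewrite (sum_multipartite n xpredT (fun i => (s i)^-1 ^+ 2)).
  rewrite (eq_bigr (fun=> 1)) ?sumr_const ?card_ord // => i _.
  by rewrite expr2 -mulrnAr inv_s mulVf.
have -> : (x *m x^T) 0 0 = k%:R.
  rewrite -sum_f2 mxE [RHS]big_enum_val.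
  by apply: eq_bigr => i _; rewrite !mxE -expr2.
have sum_f P : \sum_(u : complete_multipartite n | P (tag u)) f u
    = \sum_(i | P i) s i.
  rewrite (sum_multipartite n P (fun i => (s i)^-1)).
  by apply: eq_bigr.
rewrite (sum_f xpredT) sum_f2.
pose X := \sum_i \sum_(j | i != j) s i * s j.
have -> : \sum_u f u * \sum_(v | sedge u v) f v = X.
  rewrite (eq_bigr (fun u => (s (tag u))^-1
    * \sum_(j | tag u != j) s j)) => [|u _]; last first.
    (* Adjacency of [u] and [v] unfolds to [tag u != tag v], a condition on the part of [v]
       alone. *)
    by rewrite -(sum_f (fun i => tag u != i)).
  rewrite (sum_multipartite n xpredT
    (fun i => (s i)^-1 * \sum_(j | i != j) s j)).
  by apply: eq_bigr => i _; rewrite -mulrnAl inv_s mulr_sumr.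
(* The diagonal terms of the square are [s i ^+ 2], that is [n i]; the others form [X]. The Rayleigh
   numerator thus becomes the total number of vertices minus [k] minus [X]. *)
have -> : (\sum_i s i) ^+ 2 = (\sum_(i < k) n i)%N%:R + X.
  rewrite natr_sum -big_split expr2 mulr_suml; apply: eq_bigr => i _ /=.
  rewrite mulr_sumr (bigD1 i) //= -expr2 sqr_s; congr (_ + _).
  by apply: eq_bigl => j; rewrite eq_sym.
have XE : X = 2%:R * \sum_(i < k) \sum_(j < k | (i < j)%N)
    Num.sqrt ((n i)%:R * (n j)%:R).
  rewrite /X sum_offdiag_sym => [|i j]; last exact: mulrC.
  congr (_ * _); apply: eq_bigr => i _; apply: eq_bigr => j _.
  by rewrite sqrtrM.
(* Dividing the Rayleigh inequality by [k] already gives the bound; the two right-hand sides are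
   equal, which [field] checks. *)
rewrite mulrAC -XE -ler_pdivlMr ?ltr0n // => /le_trans-> //.
rewrite le_eqVlt; apply/orP; left; apply/eqP.
have k_neq0 : k%:R != 0 :> R by rewrite pnatr_eq0 -lt0n.
by field.
Qed.
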